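(* $\mathcal R$ is a finite-length abelian category, and hence every rational $\mathfrak{sl}(2)$-module has Jordan–Hölder filtrations by rational submodules. Moreover, $\mathcal R$ is a Krull–Schmidt category, and therefore every rational module has a Remak decomposition into a finite direct sum of indecomposable rational modules, unique up to reordering of the direct summands (and isomorphism).
   Context: $\mathfrak{sl}(2)$ has basis $L_{-1}=f$, $L_0=-\tfrac12 h$, $L_1=-e$ for a Chevalley basis $e,f,h$. Every $\mathfrak{sl}(2)$-module $(V,\rho)$ is a $\mathbb{C}[z]$-module via $z\cdot v=\rho(L_0)v$. A rational $\mathfrak{sl}(2)$-module is one which, with this structure, is a finite-dimensional $\mathbb{C}(z)$-vector space. $\mathcal R$ denotes the full subcategory of the category of $\mathfrak{sl}(2)$-modules formed by rational modules (morphisms are $\mathfrak{sl}(2)$-homomorphisms, automatically $\mathbb{C}(z)$-linear); it is an abelian $\mathbb{C}$-linear category. *)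

(* Defs.v *)
From HB Require Import structures.
From mathcomp Require Import all_boot all_algebra fraction complex.
From mathcomp Require Import Rstruct.
Set Implicit Arguments. Unset Strict Implicit. Unset Printing Implicit Defensive.
Import GRing.Theory.
Local Open Scope ring_scope.

Definition C : numClosedFieldType := (Rdefinitions.R)[i].

Definition Cz : fieldType := {fraction {poly C}}.

Record sl2mod := Sl2Mod {
  sl2V :> lmodType C;
  act_e : {linear sl2V -> sl2V};
  act_f : {linear sl2V -> sl2V};
  act_h : {linear sl2V -> sl2V};
  rel_he : forall v, act_h (act_e v) - act_e (act_h v) = 2%:R *: act_e v;
  rel_hf : forall v, act_h (act_f v) - act_f (act_h v) = - (2%:R *: act_f v);
  rel_ef : forall v, act_e (act_f v) - act_f (act_e v) = act_h v
}.

Section Defs.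
Variable V : sl2mod.

Definition L0 (v : V) : V := - (2%:R^-1 *: act_h V v).

Definition peval (p : {poly C}) (v : V) : V :=
  \sum_(i < size p) p`_i *: iter i L0 v.

Definition subs (A B : V -> Prop) := forall v, A v -> B v.
Definition seteq (A B : V -> Prop) := subs A B /\ subs B A.
Definition psubs (A B : V -> Prop) := subs A B /\ exists v, B v /\ ~ A v.
Definition zeroset : V -> Prop := fun v => v = 0.
Definition fullset : V -> Prop := fun _ => True.

Definition submodule (W : V -> Prop) : Prop :=
  W 0 /\ (forall x y, W x -> W y -> W (x + y)) /\
  (forall (c : C) x, W x -> W (c *: x)) /\
  (forall x, W x -> W (act_e V x) /\ W (act_f V x) /\ W (act_h V x)).

(* W (with the C[z]-structure z.w = L_0 w) is a finite-dimensional
   C(z)-vector space: there is a C(z)-scalar action on W extending the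
   C[z]-action, and W is finitely spanned over C(z). *)
Definition rational_on (W : V -> Prop) : Prop :=
  exists act : Cz -> V -> V,
    (forall a w, W w -> W (act a w)) /\
    (forall a w1 w2, W w1 -> W w2 -> act a (w1 + w2) = act a w1 + act a w2) /\
    (forall a b w, W w -> act (a + b) w = act a w + act b w) /\
    (forall a b w, W w -> act (a * b) w = act a (act b w)) /\
    (forall w, W w -> act 1 w = w) /\
    (forall p w, W w -> act (@FracField.tofrac _ p : Cz) w = peval p w) /\
    (exists s : seq V, (forall x, x \in s -> W x) /\
       forall w, W w -> exists c : seq Cz,
          size c = size s /\ w = \sum_(i < size s) act c`_i s`_i).

Definition rat_sub (W : V -> Prop) : Prop := submodule W /\ rational_on W.

Definition rational : Prop := rational_on fullset.

(* Jordan–Hölder filtration (composition series) of V by rational submodules: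
   0 = V_0 < V_1 < ... < V_n = V, each V_i rational, and each V_i/V_{i-1}
   simple in R, i.e. no rational submodule strictly between V_{i-1} and V_i. *)
Definition composition_series (n : nat) (Ws : nat -> V -> Prop) : Prop :=
  seteq (Ws 0%N) zeroset /\ seteq (Ws n) fullset /\
  (forall i, (i <= n)%N -> rat_sub (Ws i)) /\
  (forall i, (i < n)%N -> psubs (Ws i) (Ws i.+1) /\
      forall U, rat_sub U -> subs (Ws i) U -> subs U (Ws i.+1) ->
        seteq U (Ws i) \/ seteq U (Ws i.+1)).

Definition dsum (W : V -> Prop) (n : nat) (Ws : 'I_n -> V -> Prop) : Prop :=
  (forall i, rat_sub (Ws i)) /\
  (forall i, subs (Ws i) W) /\
  (forall w, W w -> exists x : 'I_n -> V,
       (forall i, Ws i (x i)) /\ w = \sum_(i < n) x i) /\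
  (forall x y : 'I_n -> V, (forall i, Ws i (x i)) -> (forall i, Ws i (y i)) ->
       \sum_(i < n) x i = \sum_(i < n) y i -> forall i, x i = y i).

Definition indecomposable (W : V -> Prop) : Prop :=
  rat_sub W /\ (exists w, W w /\ w <> 0) /\
  forall Ws : 'I_2 -> V -> Prop, dsum W Ws ->
    seteq (Ws ord0) zeroset \/ seteq (Ws ord_max) zeroset.

Definition morph (W1 W2 : V -> Prop) (phi : V -> V) : Prop :=
  (forall w, W1 w -> W2 (phi w)) /\
  (forall x y, W1 x -> W1 y -> phi (x + y) = phi x + phi y) /\
  (forall (c : C) x, W1 x -> phi (c *: x) = c *: phi x) /\
  (forall x, W1 x -> phi (act_e V x) = act_e V (phi x) /\
                     phi (act_f V x) = act_f V (phi x) /\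
                     phi (act_h V x) = act_h V (phi x)).

Definition iso_by (W1 W2 : V -> Prop) (phi : V -> V) : Prop :=
  morph W1 W2 phi /\ exists psi, morph W2 W1 psi /\
    (forall x, W1 x -> psi (phi x) = x) /\ (forall y, W2 y -> phi (psi y) = y).

Definition isomorphic (W1 W2 : V -> Prop) : Prop := exists phi, iso_by W1 W2 phi.

Definition local_end (W : V -> Prop) : Prop :=
  forall phi, morph W W phi -> iso_by W W phi \/ iso_by W W (fun v => v - phi v).

End Defs.

(* Main.v *)
(* A morphism commutes with L_0, hence with every p(L_0); so kernels and images
   of morphisms of rational modules are again C(z)-subspaces.  Dimension over
   C(z) is therefore a length function on rational submodules, strictly
   monotone and bounded: this gives composition series and Remak
   decompositions by induction.  Fitting's lemma, applied to the chains of
   kernels and images of powers, makes the endomorphism ring of an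
   indecomposable local, and uniqueness follows by Azumaya's exchange of
   summands. *)
Require Import Defs.
From mathcomp Require Import all_boot all_fingroup all_algebra fraction complex.
From mathcomp Require Import Rstruct.
From mathcomp Require Import boolp zify.
Set Implicit Arguments. Unset Strict Implicit. Unset Printing Implicit Defensive.
Import GRing.Theory.
Local Open Scope ring_scope.

(** Rationality of a submodule asks for some $\mathbb{C}(z)$-action on it, a priori unrelated to the
    one on [V]. The obstacle is removed by divisibility: on a rational [V] every $p(L_0)$ with $p
    \neq 0$ is injective, so a submodule is rational exactly when each such $p(L_0)$ maps it onto
    itself. This criterion involves the $\mathfrak{sl}(2)$-action alone, so it passes to kernels and
    images without carrying scalar actions along. Submodules are predicates on [V] rather than
    types, so their dimension is read off from coordinates in a spanning family of [V], as the rank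
    of a matrix. Morphisms are total maps whose values matter only on their domain; inverses and
    projections are obtained by choice. *)

(** * Bounded sets and monotone sequences of naturals *)

Lemma ex_max_nat (P : nat -> Prop) (b : nat) :
  (exists n, P n) -> (forall n, P n -> (n <= b)%N) ->
  exists n, P n /\ forall m, P m -> (m <= n)%N.
Proof.
move=> [n Pn] Pb.
have ex : exists n, `[< P n >] by exists n; apply/asboolP.
have ub m : `[< P m >] -> (m <= b)%N by move/asboolP; apply: Pb.
case: (ex_maxnP ex ub) => m /asboolP Pm mmax.
by exists m; split=> // k Pk; apply: mmax; apply/asboolP.
Qed.

(** The sequence is constant from any point where it attains its maximum. Fitting's lemma compares
    the powers [k] and [k + k]; the successor of such a point is taken to make [k] positive. *)
Lemma ex_doubling_stable (f : nat -> nat) (b : nat) :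
  {homo f : m n / (m <= n)%N} -> (forall n, (f n <= b)%N) ->
  exists2 k, (0 < k)%N & f k = f (k + k)%N.
Proof.
move=> fmono fb.
have [n|y [[x <-] xmax]] := @ex_max_nat (fun y => exists x, f x = y) b
  (ex_intro _ _ (ex_intro _ 0%N erefl)); first by case=> x <-.
have fE k : (x <= k)%N -> f k = f x.
  by move=> xk; apply/eqP; rewrite eqn_leq [(f x <= _)%N]fmono // xmax //; exists k.
by exists x.+1; rewrite ?fE // (leq_trans (leqnSn x)) // leq_addr.
Qed.

(** * Subspaces as row spaces of coordinate matrices *)

Section CoordinateMatrix.
Variables (K : fieldType) (V : zmodType) (act : K -> V -> V).
Hypothesis actDr : forall a x y, act a (x + y) = act a x + act a y.
Hypothesis actDl : forall a b x, act (a + b) x = act a x + act b x.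
Hypothesis actM : forall a b x, act (a * b) x = act a (act b x).
Variables (n : nat) (g : 'I_n -> V).

Definition lincomb (c : 'rV[K]_n) : V := \sum_i act (c 0 i) (g i).

Lemma act0r a : act a 0 = 0.
Proof. by apply: (addrI (act a 0)); rewrite -actDr !addr0. Qed.

Lemma act0l x : act 0 x = 0.
Proof. by apply: (addrI (act 0 x)); rewrite -actDl !addr0. Qed.

Lemma lincombD c1 c2 : lincomb (c1 + c2) = lincomb c1 + lincomb c2.
Proof. by rewrite -big_split; apply: eq_bigr => i _; rewrite mxE actDl. Qed.

Lemma lincombZ a c : lincomb (a *: c) = act a (lincomb c).
Proof.
rewrite /lincomb (big_morph _ (actDr a) (act0r a)).
by apply: eq_bigr => i _; rewrite mxE actM.
Qed.

Lemma lincomb0 : lincomb 0 = 0.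
Proof. by rewrite -(scale0r 0) lincombZ act0l. Qed.

(* A matrix of maximal rank among those whose rows are coordinates of vectors
   of W has all such coordinates in its row space. *)
Lemma coord_matrix (W : V -> Prop) :
  W 0 -> (forall x y, W x -> W y -> W (x + y)) ->
  (forall a x, W x -> W (act a x)) ->
  exists A : 'M[K]_n, forall c : 'rV_n, (c <= A)%MS <-> W (lincomb c).
Proof.
move=> W0 WD Wact.
pose P (A : 'M[K]_n) := forall c : 'rV_n, (c <= A)%MS -> W (lincomb c).
have [||r [[A PA <-] Amax]] :=
  @ex_max_nat (fun r => exists2 A, P A & \rank A = r) n.
- by exists (\rank (0 : 'M[K]_n)), 0 => // c /submx0null ->; rewrite lincomb0.
- by move=> r [A _ <-]; apply: rank_leq_row.
exists A => c; split=> [|Wc]; first exact: PA.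
have PAc : P (A + c)%MS.
  move=> u /sub_addsmxP[[u1 u2] ->] /=; rewrite lincombD.
  apply: WD; first by apply: PA; apply: submxMl.
  by rewrite (mx11_scalar u2) mul_scalar_mx lincombZ; apply: Wact.
have [_ eqA] := mxrank_leqif_sup (addsmxSl A c).
apply: submx_trans (addsmxSr A c) _; rewrite -eqA eqn_leq mxrankS ?addsmxSl //=.
by apply: Amax; exists (A + c)%MS.
Qed.

Hypothesis g_span : forall x, exists c, x = lincomb c.

(** [d W] is the rank of a matrix whose row space is the preimage of [W] under [lincomb]. As [g] may
    be linearly dependent, this is the dimension of [W] plus that of the space of relations; the
    excess is the same for all [W], so comparisons are unaffected. *)
Lemma length_fun_closed : exists d : (V -> Prop) -> nat,
  forall A B : V -> Prop,
    (forall W, W = A \/ W = B ->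
       [/\ W 0, forall x y, W x -> W y -> W (x + y)
         & forall a x, W x -> W (act a x)]) ->
    (forall x, A x -> B x) ->
    (d A <= d B)%N /\ (d A = d B -> forall x, B x -> A x).
Proof.
have /choice[M MP] : forall W : V -> Prop, exists A : 'M[K]_n,
    [/\ W 0, forall x y, W x -> W y -> W (x + y)
      & forall a x, W x -> W (act a x)] ->
    forall c : 'rV_n, (c <= A)%MS <-> W (lincomb c).
  move=> W; have [[W0 WD Wact]|nW] :=
    lem [/\ W 0, forall x y, W x -> W y -> W (x + y)
          & forall a x, W x -> W (act a x)].
    by have [A HA] := coord_matrix W0 WD Wact; exists A.
  by exists 0 => /nW.
exists (fun W => \rank (M W)) => A B clAB AB.
have MA := MP A (clAB A (or_introl erefl)).
have MB := MP B (clAB B (or_intror erefl)).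
have sAB : (M A <= M B)%MS.
  apply/row_subP => i; apply/MB/AB/MA; exact: row_sub.
split=> [|eqr x Bx]; first exact: mxrankS.
have [c xE] := g_span x; rewrite xE; apply/MA.
have := mxrank_leqif_sup sAB; rewrite eqr => -[_]; rewrite eqxx => /esym sBA.
by apply: submx_trans sBA; apply/MB; rewrite -xE.
Qed.

(** The rows of the coordinate matrix of [W] are coordinates of a spanning family. This supplies the
    finite spanning clause of [rational_on] for subspaces. *)
Lemma closed_span (W : V -> Prop) :
  W 0 -> (forall x y, W x -> W y -> W (x + y)) ->
  (forall a x, W x -> W (act a x)) ->
  exists2 w : 'I_n -> V, forall i, W (w i)
    & forall x, W x -> exists c : 'rV[K]_n, x = \sum_i act (c 0 i) (w i).
Proof.
move=> W0 WD Wact; have [A HA] := coord_matrix W0 WD Wact.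
exists (fun i => lincomb (row i A)) => [i|x Wx].
  by apply/HA; apply: row_sub.
have [c xE] := g_span x.
have /submxP[D cE] : (c <= A)%MS by apply/HA; rewrite -xE.
exists D; rewrite xE cE mulmx_sum_row (big_morph _ lincombD lincomb0).
by apply: eq_bigr => i _; rewrite lincombZ.
Qed.

End CoordinateMatrix.

(** * Sums over sequences and clearing of denominators *)

Lemma sum_nth_seq (T V : nmodType) (F : T -> V -> V) (c : seq T)
  (s : seq V) : size c = size s ->
  \sum_(i < size s) F c`_i s`_i = \sum_(p <- zip c s) F p.1 p.2.
Proof.
move=> cs; rewrite (big_nth (0, 0)) size_zip cs minnn big_mkord.
by apply: eq_bigr => i _; rewrite nth_zip.
Qed.

Lemma fracP (R : idomainType) (a : {fraction R}) :
  exists p q : R, q != 0 /\ FracField.tofrac q * a = FracField.tofrac p.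
Proof.
elim/generic_quotient.quotW: a => r.
exists (frac r).1, (frac r).2; split; first exact: denom_ratioP.
unlock FracField.tofrac; rewrite -[LHS]FracField.pi_mul.
apply/eqP; rewrite FracField.equivf_def /FracField.mulf.
by rewrite !numden_Ratio ?mul1r ?mulr1 ?oner_neq0 // denom_ratioP.
Qed.

(** * Submodules, morphisms and the divisibility criterion *)

Section Submodules.
Variable V : sl2mod.
Implicit Types (W A B : V -> Prop) (phi psi : V -> V).

(** Extensionality of predicates allows rewriting with equal submodules. *)
Lemma seteq_eq A B : seteq A B -> A = B.
Proof. by move=> [AB BA]; apply/predeqP => x; split; [apply: AB|apply: BA]. Qed.

Section Closure.
Variables (W : V -> Prop) (subW : submodule W).

Lemma submod0 : W 0. Proof. by case: subW. Qed.

Lemma submodD x y : W x -> W y -> W (x + y).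
Proof. by case: subW => _ [WD _]; apply: WD. Qed.

Lemma submodZ c x : W x -> W (c *: x).
Proof. by case: subW => _ [_ [WZ _]]; apply: WZ. Qed.

Lemma submodB x y : W x -> W y -> W (x - y).
Proof. by move=> Wx Wy; rewrite -scaleN1r; apply/submodD/submodZ. Qed.

Lemma submod_sum (I : Type) (r : seq I) (P : pred I) (F : I -> V) :
  (forall i, W (F i)) -> W (\sum_(i <- r | P i) F i).
Proof. by move=> WF; apply: big_ind => //; [apply: submod0|apply: submodD]. Qed.

Lemma submod_sl2 x : W x -> [/\ W (act_e V x), W (act_f V x) & W (act_h V x)].
Proof. by case: subW => _ [_ [_ Wact]] /Wact[? []]. Qed.

Lemma submod_L0 x : W x -> W (L0 x).
Proof.
by move=> /submod_sl2[_ _ Wh]; rewrite /L0 -scaleN1r; do 2!apply: submodZ.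
Qed.

Lemma submod_peval p x : W x -> W (peval p x).
Proof.
move=> Wx; apply: submod_sum => i; apply: submodZ.
by elim: (nat_of_ord i) => //= k; apply: submod_L0.
Qed.

End Closure.

Section Morphisms.
Variables (W1 W2 : V -> Prop) (phi : V -> V).
Hypotheses (subW1 : submodule W1) (mphi : morph W1 W2 phi).

Lemma morph_in x : W1 x -> W2 (phi x).
Proof. by case: mphi => H _; apply: H. Qed.

Lemma morphD x y : W1 x -> W1 y -> phi (x + y) = phi x + phi y.
Proof. by case: mphi => _ [H _]; apply: H. Qed.

Lemma morphZ c x : W1 x -> phi (c *: x) = c *: phi x.
Proof. by case: mphi => _ [_ [H _]]; apply: H. Qed.

Lemma morph_sl2 x : W1 x ->
  [/\ phi (act_e V x) = act_e V (phi x), phi (act_f V x) = act_f V (phi x)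
    & phi (act_h V x) = act_h V (phi x)].
Proof. by case: mphi => _ [_ [_ H]] /H[? []]. Qed.

Lemma morph0 : phi 0 = 0.
Proof. by rewrite -(scale0r 0) morphZ ?scale0r //; apply: submod0. Qed.

Lemma morphB x y : W1 x -> W1 y -> phi (x - y) = phi x - phi y.
Proof.
move=> Wx Wy; rewrite -scaleN1r morphD ?morphZ ?scaleN1r //.
by rewrite -scaleN1r; apply: submodZ.
Qed.

Lemma morph_sum (I : Type) (r : seq I) (P : pred I) (F : I -> V) :
  (forall i, W1 (F i)) ->
  phi (\sum_(i <- r | P i) F i) = \sum_(i <- r | P i) phi (F i).
Proof.
move=> WF; elim: r => [|i r IHr]; first by rewrite !big_nil morph0.
rewrite !big_cons; case: (P i) => //; rewrite morphD ?IHr //.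
exact: submod_sum.
Qed.

Lemma morph_peval p x : W1 x -> phi (peval p x) = peval p (phi x).
Proof.
move=> Wx; have Wi i : W1 (iter i (@L0 V) x).
  by elim: i => //= k; apply: submod_L0.
rewrite /peval morph_sum => [|i]; last exact: submodZ.
apply: eq_bigr => i _; rewrite morphZ //; congr (_ *: _).
elim: (nat_of_ord i) => //= k <-.
have [_ _ hE] := morph_sl2 (Wi k); rewrite /L0 -hE -!scaleNr morphZ //.
by have [] := submod_sl2 subW1 (Wi k).
Qed.

End Morphisms.

Lemma morph_comp A B W phi psi :
  morph A B phi -> morph B W psi -> morph A W (fun x => psi (phi x)).
Proof.
move=> mphi mpsi; do !split.
- by move=> x Ax; apply/(morph_in mpsi)/(morph_in mphi).
- by move=> x y Ax Ay; rewrite (morphD mphi) // (morphD mpsi) //;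
    apply: (morph_in mphi).
- by move=> c x Ax; rewrite (morphZ mphi) // (morphZ mpsi) //;
    apply: (morph_in mphi).
- by have [-> _ _] := morph_sl2 mphi H; have [] := morph_sl2 mpsi (morph_in mphi H).
- by have [_ -> _] := morph_sl2 mphi H; have [] := morph_sl2 mpsi (morph_in mphi H).
- by have [_ _ ->] := morph_sl2 mphi H; have [] := morph_sl2 mpsi (morph_in mphi H).
Qed.

Lemma morph_iter A phi k : morph A A phi -> morph A A (iter k phi).
Proof.
move=> mphi; elim: k => [|k IHk] /=; first by do !split.
exact: (morph_comp IHk mphi).
Qed.

Lemma morph_id_sub A phi :
  submodule A -> morph A A phi -> morph A A (fun x => x - phi x).
Proof.
move=> sA mphi; do !split.
- by move=> x Ax; apply: submodB => //; apply: (morph_in mphi).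
- by move=> x y Ax Ay; rewrite (morphD mphi) // opprD addrACA.
- by move=> c x Ax; rewrite (morphZ mphi) // scalerBr.
- by have [-> _ _] := morph_sl2 mphi H; rewrite linearB.
- by have [_ -> _] := morph_sl2 mphi H; rewrite linearB.
- by have [_ _ ->] := morph_sl2 mphi H; rewrite linearB.
Qed.

Definition ker_on (W : V -> Prop) (phi : V -> V) : V -> Prop :=
  fun x => W x /\ phi x = 0.
Definition im_on (W : V -> Prop) (phi : V -> V) : V -> Prop :=
  fun y => exists2 x, W x & y = phi x.

Lemma submodule_ker A B phi :
  submodule A -> morph A B phi -> submodule (ker_on A phi).
Proof.
move=> sA mphi; split; first by split; [apply: submod0|apply: morph0 mphi].
split=> [x y [Ax x0] [Ay y0]|].
  by split; [apply: submodD|rewrite (morphD mphi) // x0 y0 addr0].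
split=> [c x [Ax x0]|x [Ax x0]].
  by split; [apply: submodZ|rewrite (morphZ mphi) // x0 scaler0].
have [Ae Af Ah] := submod_sl2 sA Ax; have [eE fE hE] := morph_sl2 mphi Ax.
by do !split; rewrite ?eE ?fE ?hE ?x0 ?linear0.
Qed.

Lemma submodule_im A B phi :
  submodule A -> morph A B phi -> submodule (im_on A phi).
Proof.
move=> sA mphi; split; first by exists 0; [apply: submod0|rewrite (morph0 sA mphi)].
split=> [_ _ [x Ax ->] [y Ay ->]|].
  by exists (x + y); [apply: submodD|rewrite (morphD mphi)].
split=> [c _ [x Ax ->]|_ [x Ax ->]].
  by exists (c *: x); [apply: submodZ|rewrite (morphZ mphi)].
have [Ae Af Ah] := submod_sl2 sA Ax; have [eE fE hE] := morph_sl2 mphi Ax.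
split; [exists (act_e V x)|split; [exists (act_f V x)|exists (act_h V x)]];
  by rewrite ?eE ?fE ?hE.
Qed.

Lemma zeroset_submodule : submodule (@zeroset V).
Proof.
split=> //; split=> [x y -> ->|]; first by rewrite /zeroset addr0.
by split=> [c x ->|x ->]; rewrite /zeroset ?scaler0 ?linear0.
Qed.

Hypothesis ratV : rational V.

Lemma fullset_rat_sub : rat_sub (@fullset V).
Proof. by split=> //; do !split. Qed.

(** $p(L_0)$ is the action of the scalar $p$, which is invertible in $\mathbb{C}(z)$. *)
Lemma peval_inj p (x : V) : p != 0 -> peval p x = 0 -> x = 0.
Proof.
case: ratV => act [_ [actDr [_ [actM [act1 [actp _]]]]]] p0 px0.
have act0 a : act a 0 = 0 by apply: (addrI (act a 0)); rewrite -actDr ?addr0.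
rewrite -(act1 x) // -(@mulVf _ (@FracField.tofrac _ p)) ?tofrac_eq0 //.
by rewrite actM // actp // px0 act0.
Qed.

(** Both conclusions come from one fixed action [act] on [V]: a submodule is divisible iff it is
    stable under [act] iff it is rational, and [d] is a length for the [act]-stable subspaces. *)
Lemma rational_closed_length :
  exists d : (V -> Prop) -> nat,
    (forall W, rat_sub W <-> submodule W /\
       forall p w, p != 0 -> W w -> exists2 u, W u & peval p u = w) /\
    forall A B, rat_sub A -> rat_sub B -> subs A B ->
      (d A <= d B)%N /\ (d A = d B -> A = B).
Proof.
case: ratV => act [_ [actDr [actDl [actM [act1 [actp]]]]]] [s [_ s_span]].
have {}actDr a x y : act a (x + y) = act a x + act a y by apply: actDr.
have {}actDl a b x : act (a + b) x = act a x + act b x by apply: actDl.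
have {}actM a b x : act (a * b) x = act a (act b x) by apply: actM.
have {}actp p x : act (FracField.tofrac p) x = peval p x by apply: actp.
have tf0 p : p != 0 -> FracField.tofrac p != 0 :> Cz by rewrite tofrac_eq0.
have span x : exists c : 'rV_(size s), x = lincomb act (fun i => s`_i) c.
  have [//|c [sc xE]] := s_span x.
  exists (\row_i c`_i); rewrite xE; apply: eq_bigr => i _; by rewrite mxE.
pose closed W := forall a w, W w -> W (act a w).
have closedP W : submodule W -> closed W <->
    forall p w, p != 0 -> W w -> exists2 u, W u & peval p u = w.
  move=> sW; split=> [cW p w p0 Ww|dW a w Ww].
    exists (act (FracField.tofrac p)^-1 w); first exact: cW.
    by rewrite -actp -actM mulfV ?tf0 ?act1.
  (* With $a = p/q$ and $w = q(L_0)u$, the vector $a \cdot w$ equals $p(L_0)u$. *)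
  have [p [q [q0 aE]]] := fracP a.
  have [u Wu <-] := dW _ _ q0 Ww.
  by rewrite -actp -actM mulrC aE actp; apply: submod_peval.
have ratP W : rat_sub W <-> submodule W /\ closed W.
  (* Nothing says that [actW] agrees with [act]; it is used only to divide by $p(L_0)$ inside
     [W]. *)
  split=> [[sW [actW [H1 [_ [_ [H4 [H5 [H6 _]]]]]]]]|[sW cW]].
    split=> //; apply/closedP => // p w p0 Ww.
    exists (actW (FracField.tofrac p)^-1 w); first exact: H1.
    rewrite -H6; last exact: H1.
    by rewrite -H4 // mulfV ?tf0 ?H5.
  rewrite /closed in cW; split=> //; exists act.
  do 6![split; first by move=> *; rewrite ?act1; auto].
  have [w Ww w_span] := closed_span actDr actDl actM span (submod0 sW)
    (submodD sW) cW.
  exists (map w (enum 'I_(size s))); split=> [_ /mapP[i _ ->]//|x /w_span[c xE]].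
  exists [seq c 0 i | i <- enum 'I_(size s)]; rewrite sum_nth_seq !size_map //.
  split=> //.
  by rewrite zip_map big_map big_enum.
have [d dP] := length_fun_closed actDr actDl actM span.
exists d; split=> [W|A B /ratP[sA cA] /ratP[sB cB] sAB].
  rewrite ratP; split=> -[sW cW]; split=> //; exact/closedP.
have [|dle deq] := dP A B _ sAB.
  by move=> W [] ->; split=> //; by [apply: submod0|apply: submodD].
by split=> // /deq BA; apply: seteq_eq.
Qed.

Lemma rat_subP W : rat_sub W <-> submodule W /\
  forall p w, p != 0 -> W w -> exists2 u, W u & peval p u = w.
Proof. by have [d [H _]] := rational_closed_length. Qed.

Lemma rat_length : exists d : (V -> Prop) -> nat,
  forall A B, rat_sub A -> rat_sub B -> subs A B ->
    (d A <= d B)%N /\ (d A = d B -> A = B).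
Proof. by have [d [_ H]] := rational_closed_length; exists d. Qed.

Lemma zeroset_rat_sub : rat_sub (@zeroset V).
Proof.
apply/rat_subP; split=> [|p _ p0 ->]; first exact: zeroset_submodule.
by exists 0 => //; apply: (submod_peval zeroset_submodule).
Qed.

Lemma rat_sub_ker A B phi :
  rat_sub A -> morph A B phi -> rat_sub (ker_on A phi).
Proof.
move=> /rat_subP[sA divA] mphi; apply/rat_subP.
split=> [|p w p0 [Aw w0]]; first exact: submodule_ker mphi.
have [u Au uE] := divA p w p0 Aw; exists u => //; split=> //.
(* Here $p(L_0)\phi(u) = \phi(p(L_0)u) = \phi(w) = 0$, so the preimage [u] is again in the
   kernel. *)
by apply: (peval_inj p0); rewrite -(morph_peval sA mphi) // uE.
Qed.

Lemma rat_sub_im A B phi :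
  rat_sub A -> morph A B phi -> rat_sub (im_on A phi).
Proof.
move=> /rat_subP[sA divA] mphi; apply/rat_subP.
split=> [|p _ p0 [w Aw ->]]; first exact: submodule_im mphi.
have [u Au uE] := divA p w p0 Aw; exists (phi u); first by exists u.
by rewrite -(morph_peval sA mphi) // uE.
Qed.

End Submodules.

(** * Isomorphisms and local endomorphism rings *)

Section Isomorphisms.
Variable V : sl2mod.
Implicit Types (A B W : V -> Prop) (phi psi : V -> V).

Lemma bij_iso_by A B phi : submodule A -> morph A B phi ->
  (forall x, A x -> phi x = 0 -> x = 0) ->
  (forall y, B y -> exists2 x, A x & phi x = y) -> iso_by A B phi.
Proof.
move=> sA mphi inj0 surj; split=> //.
have inj x y : A x -> A y -> phi x = phi y -> x = y.
  move=> Ax Ay xy; apply/eqP; rewrite -subr_eq0; apply/eqP/inj0.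
    exact: submodB.
  by rewrite (morphB sA mphi) // xy subrr.
have /choice[psi psiP] : forall y, exists x, B y -> A x /\ phi x = y.
  move=> y; have [/surj[x Ax xy]|nB] := lem (B y); first by exists x.
  by exists 0 => /nB.
have A_psi y : B y -> A (psi y) by case/psiP.
have psiK y : B y -> phi (psi y) = y by case/psiP.
have phiK x : A x -> psi (phi x) = x.
  move=> Ax; have Bx := morph_in mphi Ax.
  by apply: inj; rewrite ?psiK //; apply: A_psi.
exists psi; split=> //; split=> //.
split=> [x y Bx By|].
  rewrite -{1}(psiK x) // -{1}(psiK y) // -(morphD mphi) ?phiK //; try exact: A_psi.
  by apply: submodD => //; apply: A_psi.
split=> [c x Bx|x Bx].
  rewrite -{1}(psiK x) // -(morphZ mphi) ?phiK //; try exact: A_psi.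
  by apply: submodZ => //; apply: A_psi.
have [Ae Af Ah] := submod_sl2 sA (A_psi x Bx).
have [eE fE hE] := morph_sl2 mphi (A_psi x Bx).
by rewrite -{1 3 5}(psiK x) // -eE -fE -hE !phiK.
Qed.

Lemma iso_by_inj0 A B phi x :
  submodule A -> iso_by A B phi -> A x -> phi x = 0 -> x = 0.
Proof.
move=> sA [mphi [psi [_ [phiK _]]]] Ax x0.
by rewrite -(phiK x) // x0 -{1}(morph0 sA mphi) phiK //; apply: (submod0 sA).
Qed.

Lemma iso_by_surj A B phi y : iso_by A B phi -> B y -> exists2 x, A x & phi x = y.
Proof.
move=> [_ [psi [mpsi [_ psiK]]]] By.
by exists (psi y); [apply: (morph_in mpsi)|apply: psiK].
Qed.

Lemma iso_by_comp A B W phi psi :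
  iso_by A B phi -> iso_by B W psi -> iso_by A W (fun x => psi (phi x)).
Proof.
move=> [m1 [f1 [n1 [K1 L1]]]] [m2 [f2 [n2 [K2 L2]]]].
split; first exact: morph_comp m1 m2.
exists (fun y => f1 (f2 y)); split; first exact: morph_comp n2 n1.
by split=> x Wx; rewrite ?K2 ?K1 ?L1 ?L2 //;
  [apply: (morph_in m1)|apply: (morph_in n2)].
Qed.

(** Maps are total on [V], and the identities met below hold only on [A]; they must still transport
    invertibility. *)
Lemma iso_by_ext A B phi psi : submodule A ->
  (forall x, A x -> phi x = psi x) -> iso_by A B phi -> iso_by A B psi.
Proof.
move=> sA E iphi; have [mphi _] := iphi; apply: bij_iso_by => //.
- do !split.
  + by move=> x Ax; rewrite -E //; apply: (morph_in mphi).
  + move=> x y Ax Ay; rewrite -!E // ?(morphD mphi) //; exact: submodD.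
  + move=> c x Ax; rewrite -!E // ?(morphZ mphi) //; exact: submodZ.
  + have [Ae _ _] := submod_sl2 sA H.
    by rewrite -!E //; have [] := morph_sl2 mphi H.
  + have [_ Af _] := submod_sl2 sA H.
    by rewrite -!E //; have [] := morph_sl2 mphi H.
  + have [_ _ Ah] := submod_sl2 sA H.
    by rewrite -!E //; have [] := morph_sl2 mphi H.
- by move=> x Ax; rewrite -E //; apply: iso_by_inj0 iphi _.
- by move=> y /(iso_by_surj iphi)[x Ax <-]; exists x; rewrite -?E.
Qed.

Lemma isomorphic_sym A B : isomorphic A B -> isomorphic B A.
Proof.
by move=> [phi [mphi [psi [mpsi [K L]]]]]; exists psi; split=> //; exists phi.
Qed.

(** In a local ring a sum that is a unit has a unit among its terms. Composing with the inverse [t]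
    of the sum turns it into the identity, and locality decides between the first term and the rest.
    A nonzero vector excludes the empty sum. *)
Lemma local_end_sum A (I : Type) (r : seq I) (phi : I -> V -> V) :
  submodule A -> local_end A -> (exists2 x, A x & x <> 0) ->
  (forall i, morph A A (phi i)) ->
  iso_by A A (fun x => \sum_(i <- r) phi i x) ->
  exists i, iso_by A A (phi i).
Proof.
move=> sA locA [x0 Ax0 nx0] mphi; elim: r => [|i r IHr] iso.
  by case: nx0; apply: (iso_by_inj0 sA iso Ax0); rewrite big_nil.
have msum : morph A A (fun x => \sum_(j <- r) phi j x).
  have [mi _] := iso; do !split.
  - by move=> x Ax; apply: submod_sum => // j; apply: (morph_in (mphi j)).
  - move=> x y Ax Ay; rewrite -big_split; apply: eq_bigr => j _.
    exact: (morphD (mphi j)).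
  - move=> c x Ax; rewrite scaler_sumr; apply: eq_bigr => j _.
    exact: (morphZ (mphi j)).
  - by rewrite linear_sum; apply: eq_bigr => j _; have [] := morph_sl2 (mphi j) H.
  - by rewrite linear_sum; apply: eq_bigr => j _; have [] := morph_sl2 (mphi j) H.
  - by rewrite linear_sum; apply: eq_bigr => j _; have [] := morph_sl2 (mphi j) H.
have [_ [t [mt [tK Kt]]]] := iso.
have cancel f : morph A A f -> iso_by A A (fun x => t (f x)) -> iso_by A A f.
  move=> mf itf; apply: iso_by_ext (iso_by_comp itf iso) => // x Ax.
  by rewrite Kt //; apply: (morph_in mf).
have [/cancel iso1|iso2] := locA _ (morph_comp (mphi i) mt).
  by exists i; apply: iso1.
(* On [A], the map $1 - t\phi_i$ is [t] composed with the sum of the remaining terms. *)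
apply/IHr/cancel => //; apply: iso_by_ext iso2 => // x Ax.
have := tK x Ax; rewrite big_cons (morphD mt).
- by move=> xE; rewrite -{1}xE [X in X - _]addrC addrK.
- exact: (morph_in (mphi i)).
- exact: (morph_in msum).
Qed.

End Isomorphisms.

(** * Internal direct sums and their projections *)

Section DirectSums.
Variable V : sl2mod.
Implicit Types (A B W : V -> Prop) (phi psi : V -> V).

Lemma dsum_submodule W n (Ws : 'I_n -> V -> Prop) i : dsum W Ws -> submodule (Ws i).
Proof. by case=> /(_ i)[]. Qed.

(** Components are picked by choice; uniqueness of the decomposition forces the choice to be linear
    and $\mathfrak{sl}(2)$-equivariant. *)
Lemma dsum_proj W n (Ws : 'I_n -> V -> Prop) : submodule W -> dsum W Ws ->
  exists c : 'I_n -> V -> V,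
    [/\ forall i, morph W (Ws i) (c i), forall v, W v -> v = \sum_i c i v,
      forall i x, Ws i x -> c i x = x
    & forall i j x, i != j -> Ws j x -> c i x = 0].
Proof.
move=> sW D; have sWs i : submodule (Ws i) := dsum_submodule i D.
case: D => _ [WsW [ex uniq]].
have /choice[c cP] : forall v, exists x : 'I_n -> V,
    W v -> (forall i, Ws i (x i)) /\ v = \sum_i x i.
  move=> v; have [/ex[x xP]|nW] := lem (W v); first by exists x.
  by exists (fun=> 0) => /nW.
have cin v i : W v -> Ws i (c v i) by case/cP.
have csum v : W v -> v = \sum_i c v i by case/cP.
have cE v x i : W v -> (forall i, Ws i (x i)) -> v = \sum_i x i -> c v i = x i.
  move=> Wv xWs vE; apply: uniq => //; first by move=> j; apply: cin.
  by rewrite -csum.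
have single i x j : Ws i x -> c x j = if j == i then x else 0.
  move=> Wx; apply: (cE x (fun j => if j == i then x else 0)).
  - exact: WsW Wx.
  - by move=> k; case: eqP => [->//|_]; apply: submod0.
  - by rewrite -big_mkcond big_pred1_eq.
exists (fun i v => c v i); split.
- move=> i; do !split; first by move=> v; apply: cin.
  + move=> x y Wx Wy; apply: (cE _ (fun j => c x j + c y j)); first exact: submodD.
      by move=> j; apply: submodD => //; apply: cin.
    by rewrite big_split -!csum.
  + move=> a x Wx; apply: (cE _ (fun j => a *: c x j)); first exact: submodZ.
      by move=> j; apply: submodZ => //; apply: cin.
    by rewrite -scaler_sumr -csum.
  + apply: (cE _ (fun j => act_e V (c x j))); first by have [] := submod_sl2 sW H.
      by move=> j; have [] := submod_sl2 (sWs j) (cin _ j H).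
    by rewrite -linear_sum -csum.
  + apply: (cE _ (fun j => act_f V (c x j))); first by have [] := submod_sl2 sW H.
      by move=> j; have [] := submod_sl2 (sWs j) (cin _ j H).
    by rewrite -linear_sum -csum.
  + apply: (cE _ (fun j => act_h V (c x j))); first by have [] := submod_sl2 sW H.
      by move=> j; have [] := submod_sl2 (sWs j) (cin _ j H).
    by rewrite -linear_sum -csum.
- exact: csum.
- by move=> i x /single ->; rewrite eqxx.
- by move=> i j x /negPf ij /single ->; rewrite ij.
Qed.

Lemma dsum_indep W n (Ws : 'I_n -> V -> Prop) :
  (forall i, rat_sub (Ws i)) -> (forall i, subs (Ws i) W) ->
  (forall w, W w -> exists x : 'I_n -> V,
     (forall i, Ws i (x i)) /\ w = \sum_i x i) ->
  (forall x : 'I_n -> V, (forall i, Ws i (x i)) -> \sum_i x i = 0 ->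
     forall i, x i = 0) -> dsum W Ws.
Proof.
move=> rWs WsW ex indep; do 3!split=> //.
move=> x y xW yW xy i; apply/eqP; rewrite -subr_eq0; apply/eqP.
apply: (indep (fun i => x i - y i)); last by rewrite sumrB xy subrr.
by move=> j; apply: submodB => //; case: (rWs j).
Qed.

Definition pair_family A B (i : 'I_2) : V -> Prop := if i == ord0 then A else B.

Lemma dsum_pair W A B : rat_sub A -> rat_sub B -> subs A W -> subs B W ->
  (forall w, W w -> exists2 b, B b & A (w - b)) ->
  (forall x, A x -> B x -> x = 0) -> dsum W (pair_family A B).
Proof.
move=> rA rB AW BW ex disj; have [[sA _] [sB _]] := (rA, rB).
apply: dsum_indep; try by move=> i; rewrite /pair_family; case: eqP.
  move=> w /ex[b Bb Ab]; exists (fun i : 'I_2 => if i == ord0 then w - b else b).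
  split=> [i|]; first by rewrite /pair_family; case: eqP.
  by rewrite big_ord_recl big_ord1 /= subrK.
move=> x xP; rewrite big_ord_recl big_ord1 => x0.
have A0 : A (x ord0) := xP ord0.
have B1 : B (x (lift ord0 ord0)) := xP (lift ord0 ord0).
have x0E : x ord0 = 0.
  apply: disj => //; move/eqP: x0; rewrite addr_eq0 => /eqP ->.
  by rewrite -sub0r; apply: submodB => //; apply: submod0.
move: x0; rewrite x0E add0r => x1 i.
have [->//|] := eqVneq i ord0; case: (unliftP ord0 i) => [j ->|->];
  last by rewrite eqxx.
by rewrite ord1.
Qed.

(** The decomposition is phrased through [w - b] because in each use [A] is a kernel and [B] an
    image: one finds [b] in the image having the same value as [w] under the map. *)
Lemma indecomposable_pair W A B : indecomposable W ->
  rat_sub A -> rat_sub B -> subs A W -> subs B W ->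
  (forall w, W w -> exists2 b, B b & A (w - b)) ->
  (forall x, A x -> B x -> x = 0) -> A = @zeroset V \/ B = @zeroset V.
Proof.
move=> [_ [_ ind]] rA rB AW BW ex disj.
have := ind _ (dsum_pair rA rB AW BW ex disj).
by case=> /seteq_eq; [left|right].
Qed.

Lemma dsum_cat W (Ws : 'I_2 -> V -> Prop) n m (As : 'I_n -> V -> Prop)
    (Bs : 'I_m -> V -> Prop) :
  submodule W ->
  dsum W Ws -> dsum (Ws ord0) As -> dsum (Ws ord_max) Bs ->
  dsum W (fun i : 'I_(n + m) =>
    match split i with inl a => As a | inr b => Bs b end).
Proof.
move=> sW D DA DB.
have sA := dsum_submodule ord0 D; have sB := dsum_submodule ord_max D.
case: D => rW [WsW [ex uniq]]; case: DA => rA [AsA [exA uniqA]].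
case: DB => rB [BsB [exB uniqB]].
apply: dsum_indep.
- by move=> i; case: split.
- by move=> i x; case: split => j; [move/AsA/WsW|move/BsB/WsW].
- move=> w /ex[x [xP ->]]; have [a [aP aE]] := exA _ (xP ord0).
  have [b [bP bE]] := exB _ (xP ord_max).
  exists (fun i => match split i with inl j => a j | inr j => b j end).
  split=> [i|]; first by case: split.
  rewrite big_split_ord big_ord_recl big_ord1 aE.
  have -> : lift ord0 ord0 = ord_max :> 'I_2 by apply: val_inj.
  rewrite bE; congr (_ + _); apply: eq_bigr => i _.
    by rewrite (unsplitK (inl i)).
  by rewrite (unsplitK (inr i)).
move=> x xP; rewrite big_split_ord /=.
set a := \sum_i x (lshift m i); set b := \sum_i x (rshift n i) => ab0.
have aP i : As i (x (lshift m i))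
  by move: (xP (lshift m i)); rewrite (unsplitK (inl i)).
have bP i : Bs i (x (rshift n i))
  by move: (xP (rshift n i)); rewrite (unsplitK (inr i)).
have Aa : Ws ord0 a by apply: submod_sum => // i; apply/AsA/aP.
have Bb : Ws ord_max b by apply: submod_sum => // i; apply/BsB/bP.
(* The partial sums [a] and [b] are the components of 0 in the coarse decomposition, hence both
   vanish; each finer decomposition then kills its own terms. *)
pose z (i : 'I_2) := if i == ord0 then a else b.
have zP i : Ws i (z i).
  rewrite /z; case: eqP => [->//|]; case: (unliftP ord0 i) => [j ->|->] // _.
  by rewrite ord1; have -> : lift ord0 ord0 = ord_max :> 'I_2 by apply: val_inj.
have z0 i : z i = 0.
  apply: (uniq z (fun=> 0)) => //; first by move=> j; apply: submod0; case: (rW j).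
  by rewrite big_ord_recl big_ord1 big1.
have a0 : a = 0 := z0 ord0; have b0 : b = 0 := z0 ord_max.
move=> i; rewrite -(splitK i); case: split => j /=.
  apply: (uniqA (fun j => x (lshift m j)) (fun=> 0)) => //.
    by move=> k; apply: submod0; case: (rA k).
  by rewrite -/a a0 big1.
apply: (uniqB (fun j => x (rshift n j)) (fun=> 0)) => //.
  by move=> k; apply: submod0; case: (rB k).
by rewrite -/b b0 big1.
Qed.

End DirectSums.

(** * Composition series, Fitting's lemma and Remak decompositions *)

Section FiniteLength.
Variable V : sl2mod.
Hypothesis ratV : rational V.
Implicit Types (A B W : V -> Prop) (phi psi : V -> V).

Lemma rat_sub_ind (P : (V -> Prop) -> Prop) :
  (forall W, rat_sub W ->
     (forall A, rat_sub A -> subs A W -> A <> W -> P A) -> P W) ->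
  forall W, rat_sub W -> P W.
Proof.
move=> step W; have [d dP] := rat_length ratV.
move: {2}(d W) (leqnn (d W)) => n; elim: n W => [|n IHn] W dW rW.
all: apply: step => // A rA AW neqAW; have [dle deq] := dP A W rA rW AW.
all: have {deq} dlt : (d A < d W)%N by rewrite ltn_neqAle dle andbT; apply/eqP => /deq.
  by rewrite leqNgt (leq_ltn_trans _ dlt) in dW.
by apply: IHn => //; rewrite -ltnS (leq_trans dlt).
Qed.

Lemma psubs_neq A B : subs A B -> A <> B -> psubs A B.
Proof.
move=> AB neq; split=> //; apply: contrapT => nex; apply: neq.
apply: seteq_eq; split=> // v Bv; apply: contrapT => nAv.
by apply: nex; exists v.
Qed.

(** A proper rational submodule [M] of largest length is maximal, so it can be placed just below
    [W]; induction provides the chain up to [M]. *)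
Lemma composition_chain W : rat_sub W ->
  exists n (Ws : nat -> V -> Prop),
    [/\ Ws 0%N = @zeroset V, Ws n = W, forall i, (i <= n)%N -> rat_sub (Ws i)
      & forall i, (i < n)%N -> psubs (Ws i) (Ws i.+1) /\
        forall U, rat_sub U -> subs (Ws i) U -> subs U (Ws i.+1) ->
          seteq U (Ws i) \/ seteq U (Ws i.+1)].
Proof.
move: W; apply: rat_sub_ind => W rW IH.
have [W0|nzW] := lem (W = @zeroset V).
  by exists 0%N, (fun=> W); split=> // i; rewrite ltn0.
have [d dP] := rat_length ratV; have rZ := zeroset_rat_sub ratV.
pose proper A := [/\ rat_sub A, subs A W & A <> W].
have propZ : proper (@zeroset V).
  split=> [//|_ ->|/esym//]; apply: submod0; exact: rW.1.
have [||m [[M [rM MW neqMW] <-] Mmax]] :=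
  @ex_max_nat (fun n => exists2 A, proper A & d A = n) (d W).
- by exists (d (@zeroset V)), (@zeroset V).
- by move=> _ [A [rA AW _] <-]; have [] := dP A W rA rW AW.
have [n [Ws [Ws0 Wsn rWs stepWs]]] := IH M rM MW neqMW.
exists n.+1, (fun i => if (i <= n)%N then Ws i else W).
split=> [//||i _|i]; rewrite ?ltnn //.
  by case: leqP => // /rWs.
rewrite ltnS => le_in; rewrite le_in; case: ltnP => [/stepWs//|le_ni].
have -> : i = n by apply/eqP; rewrite eqn_leq le_in.
rewrite Wsn; split=> [|U rU MU UW]; first exact: psubs_neq.
have [->|neqUW] := lem (U = W); [by right; split|left].
have [dle deq] := dP M U rM rU MU.
have <- : M = U; last by split.
apply/deq/eqP; rewrite eqn_leq dle /=.
by apply: Mmax; exists U.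
Qed.

Lemma fitting W phi : rat_sub W -> morph W W phi ->
  exists2 k, (0 < k)%N &
    (forall w, W w -> exists2 b, im_on W (iter k phi) b
       & ker_on W (iter k phi) (w - b)) /\
    (forall x, ker_on W (iter k phi) x -> im_on W (iter k phi) x -> x = 0).
Proof.
move=> rW mphi; have [sW _] := rW; have [d dP] := rat_length ratV.
have mi k := morph_iter k mphi.
pose K k := ker_on W (iter k phi); pose I k := im_on W (iter k phi).
have rK k : rat_sub (K k) := rat_sub_ker ratV rW (mi k).
have rI k : rat_sub (I k) := rat_sub_im ratV rW (mi k).
have KW k : subs (K k) W by move=> x [].
have IW k : subs (I k) W by move=> _ [x Wx ->]; apply: (morph_in (mi k)).
have Kmono m n : (m <= n)%N -> subs (K m) (K n).
  move=> /subnK <- x [Wx x0]; split=> //.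
  by rewrite iterD x0 (morph0 sW (mi _)).
have Imono m n : (m <= n)%N -> subs (I n) (I m).
  move=> /subnKC <- _ [x Wx ->]; rewrite iterD.
  by eexists; last reflexivity; apply: (morph_in (mi _)).
(* Both terms grow with [k], so one index at which [f] is stable stabilises the kernels and the
   images together. *)
pose f k := (d (K k) + (d W - d (I k)))%N.
have dK m n : (m <= n)%N -> (d (K m) <= d (K n))%N.
  by move=> /Kmono /(dP _ _ (rK m) (rK n))[].
have dI m n : (m <= n)%N -> (d (I n) <= d (I m))%N.
  by move=> /Imono /(dP _ _ (rI n) (rI m))[].
have dIW k : (d (I k) <= d W)%N by have [] := dP _ _ (rI k) rW (IW k).
have [|k|k k0 fk] := @ex_doubling_stable f (d W + d W).
- by move=> m n mn; rewrite leq_add ?dK ?leq_sub2l ?dI.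
- by rewrite leq_add ?leq_subr //; have [] := dP _ _ (rK k) rW (KW k).
have lekk : (k <= k + k)%N := leq_addr k k.
have [eqK eqI] : d (K k) = d (K (k + k)%N) /\ d (I (k + k)%N) = d (I k).
  have := dK _ _ lekk; have := dI _ _ lekk; have := dIW k; have := dIW (k + k)%N.
  by move: fk; rewrite /f; lia.
have {}eqK : K k = K (k + k)%N.
  by have [_ ->] := dP _ _ (rK k) (rK (k + k)%N) (Kmono _ _ lekk).
have {}eqI : I (k + k)%N = I k.
  by have [_ ->] := dP _ _ (rI (k + k)%N) (rI k) (Imono _ _ lekk).
exists k => //; split=> [w Ww|x [_ x0] [y Wy xE]].
  (* Since $\phi^k w = \phi^{2k} y$, the vector $w - \phi^k y$ lies in the kernel of $\phi^k$. *)
  have [y Wy yE] : I (k + k)%N (iter k phi w) by rewrite eqI; exists w.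
  have Wky := morph_in (mi k) Wy.
  exists (iter k phi y); first by exists y.
  split; first exact: submodB.
  by rewrite (morphB sW (mi k)) // -iterD -yE subrr.
(* If $x = \phi^k y$ is killed by $\phi^k$, then [y] is in the kernel of $\phi^{2k}$, which is that
   of $\phi^k$; so $x = 0$. *)
have : K (k + k)%N y by split=> //; rewrite iterD -xE.
by rewrite -eqK xE => -[].
Qed.

Lemma indecomposable_local_end W : indecomposable W -> local_end W.
Proof.
move=> indW phi mphi; have [rW _] := indW; have [sW _] := rW.
have [k k0 [ex disj]] := fitting rW mphi.
have mk := morph_iter k mphi.
have [||K0|I0] := indecomposable_pair indW (rat_sub_ker ratV rW mk)
  (rat_sub_im ratV rW mk) _ _ ex disj.
- by move=> x [].
- by move=> _ [x Wx ->]; apply: (morph_in mk).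
- left; apply: bij_iso_by => // [x Wx x0|y /ex[b [x Wx bE]]].
    have : ker_on W (iter k phi) x.
      (* Positivity of [k] matters: $\phi x = 0$ gives $\phi^k x = 0$ only for $k > 0$. *)
      split=> //; case: k k0 {ex disj mk K0} => // k _.
      by rewrite iterSr x0 (morph0 sW (morph_iter k mphi)).
    by rewrite K0.
  rewrite K0 => /eqP; rewrite subr_eq0 bE => /eqP ->.
  case: k k0 {ex disj mk K0 bE} => // k _.
  by exists (iter k phi x); [apply: (morph_in (morph_iter k mphi))|].
right; have nilp x : W x -> iter k phi x = 0.
  move=> Wx; have : im_on W (iter k phi) (iter k phi x) by exists x.
  by rewrite I0.
apply: bij_iso_by => // [|x Wx /eqP|y].
- exact: morph_id_sub.
- rewrite subr_eq0 => /eqP xE; rewrite -(nilp x Wx).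
  by elim: k {k0 ex disj mk I0 nilp} => //= j <-.
move=> Wy; move: (nilp y Wy); move: {k0 ex disj mk I0 nilp}k => k.
elim: k y Wy => [|k IHk] y Wy; first move=> /= ->.
  by exists 0; [apply: submod0|rewrite (morph0 sW mphi) subrr].
have Wp := morph_in mphi Wy.
(* The geometric series for $(1-\phi)^{-1}$ built recursively: if $(1-\phi)u = \phi y$ then
   $(1-\phi)(y+u) = y$. *)
rewrite iterSr => /(IHk _ Wp)[u Wu uE]; exists (y + u); first exact: submodD.
by rewrite (morphD mphi) // opprD addrACA uE subrK.
Qed.

Lemma remak_decomposition W : rat_sub W ->
  exists (n : nat) (Ws : 'I_n -> V -> Prop),
    dsum W Ws /\ forall i, indecomposable (Ws i).
Proof.
move: W; apply: rat_sub_ind => W rW IH; have [sW _] := rW.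
have [W0|nzW] := lem (W = @zeroset V).
  exists 0%N, (fun=> W); split; last by case.
  apply: dsum_indep; [by case|by case| |by move=> x _ _ []].
  by move=> w; rewrite W0 => ->; exists (fun=> 0); split; [case|rewrite big_ord0].
have [indW|decW] := lem (indecomposable W).
  exists 1%N, (fun=> W); split=> //; apply: dsum_indep; [by []|by move=> i x| |].
    by move=> w Ww; exists (fun=> w); split; rewrite ?big_ord1.
  by move=> x xW; rewrite big_ord1 => x0 i; rewrite ord1.
have [Ws [D nz0 nz1]] : exists Ws : 'I_2 -> V -> Prop,
    [/\ dsum W Ws, Ws ord0 <> @zeroset V & Ws ord_max <> @zeroset V].
  apply: contrapT => nex; apply: decW; split=> //; split.
    apply: contrapT => nexW; apply: nzW; apply: seteq_eq.
    split=> [w Ww|_ ->]; last exact: submod0.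
    by apply: contrapT => wn0; apply: nexW; exists w.
  move=> Ws D; apply: contrapT => nor; apply: nex; exists Ws.
  by split=> // E; apply: nor; rewrite E; [left; split|right; split].
have [rWs [WsW _]] := D; have [c [_ _ cid c0]] := dsum_proj sW D.
(* If [Ws i] were all of [W], projection [i] would fix each vector of [Ws j] and also kill it. *)
have proper i j : i != j -> Ws j <> @zeroset V -> Ws i <> W.
  move=> ij nzj E; apply: nzj; apply: seteq_eq.
  split=> [x Wx|_ ->]; last by apply: submod0; case: (rWs j).
  by rewrite /zeroset -(c0 i j x) // cid // E; apply: WsW Wx.
have [n [As [DA indA]]] :=
  IH _ (rWs ord0) (WsW ord0) (proper ord0 ord_max isT nz1).
have [m [Bs [DB indB]]] :=
  IH _ (rWs ord_max) (WsW ord_max) (proper ord_max ord0 isT nz0).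
exists (n + m)%N; eexists; split; first exact: dsum_cat sW D DA DB.
by move=> i /=; case: (split i) => a; [apply: indA|apply: indB].
Qed.

End FiniteLength.

(** * Azumaya exchange and uniqueness of summands *)

Section Uniqueness.
Variable V : sl2mod.
Hypothesis ratV : rational V.

(** On $U_j$ the identity is $\sum_i q_j p_i$, so locality makes some $q_j p_i$ invertible there.
    Then $q_j$ restricts to an isomorphism $W_i \to U_j$, which makes $W_i$ a complement of $\ker
    q_j = \bigoplus_{l \ne j} U_l$. *)
Lemma dsum_exchange n m (Ws : 'I_n -> V -> Prop) (Us : 'I_m -> V -> Prop) j :
  dsum (@fullset V) Ws -> (forall i, indecomposable (Ws i)) ->
  dsum (@fullset V) Us -> indecomposable (Us j) ->
  exists i, isomorphic (Us j) (Ws i) /\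
    dsum (@fullset V) (fun l => if l == j then Ws i else Us l).
Proof.
move=> DW indW DU indU; have [[sV _] rU] := (fullset_rat_sub ratV, DU.1).
have [p [mp psum _ _]] := dsum_proj sV DW.
have [q [mq qsum qid q0]] := dsum_proj sV DU.
have sU l : submodule (Us l) := dsum_submodule l DU.
have restr (A B : V -> Prop) phi : morph (@fullset V) B phi -> morph A B phi.
  by move=> mphi; apply: (@morph_comp _ _ (@fullset V) _ id) mphi; do !split.
have mqp i : morph (Us j) (Us j) (fun x => q j (p i x)).
  exact: morph_comp (restr _ _ _ (mp i)) (restr _ _ _ (mq j)).
have [i isoqp] : exists i, iso_by (Us j) (Us j) (fun x => q j (p i x)).
  apply: (local_end_sum (r := enum 'I_n) (sU j)) => //.
  - exact: (indecomposable_local_end ratV indU).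
  - by have [_ [[x [Ux nx0]] _]] := indU; exists x.
  have iso_id : iso_by (Us j) (Us j) id.
    by split; [|exists id]; do !split.
  apply: iso_by_ext iso_id => // x Ux.
  by rewrite big_enum -(morph_sum sV (mq j)) // -psum // qid.
have rW := (indW i).1; have sW : submodule (Ws i) by case: rW.
have mpi : morph (Us j) (Ws i) (p i) by apply: restr.
have mqi : morph (Ws i) (Us j) (q j) by apply: restr.
(* W_i = p_i(U_j) (+) ker q_j because q_j p_i is invertible on U_j. *)
have kerq0 : ker_on (Ws i) (q j) = @zeroset V.
  have [||||//|I0] := indecomposable_pair (indW i) (rat_sub_ker ratV rW mqi)
    (rat_sub_im ratV (rU j) mpi).
  - by move=> x [].
  - by move=> _ [x Ux ->]; apply: (morph_in mpi).
  - move=> w Ww; have Uq := morph_in mqi Ww.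
    have [x Ux xE] := iso_by_surj isoqp Uq.
    have Wp := morph_in mpi Ux.
    exists (p i x); first by exists x.
    split; first exact: submodB.
    by rewrite (morphB sW mqi) // xE subrr.
  - move=> y [_ y0] [x Ux yE]; rewrite yE in y0 *.
    by rewrite (iso_by_inj0 (sU j) isoqp Ux y0) (morph0 (sU j) mpi).
  have [_ [[x [Ux nx0]] _]] := indU; case: nx0.
  apply: (iso_by_inj0 (sU j) isoqp Ux).
  have : im_on (Us j) (p i) (p i x) by exists x.
  by rewrite I0 => ->; apply: (morph0 sW mqi).
have q_inj x : Ws i x -> q j x = 0 -> x = 0.
  by move=> Wx x0; have : ker_on (Ws i) (q j) x by []; rewrite kerq0.
have q_surj y : Us j y -> exists2 x, Ws i x & q j x = y.
  move=> /(iso_by_surj isoqp)[x Ux xE]; exists (p i x) => //.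
  exact: (morph_in mpi).
exists i; split; first by apply: isomorphic_sym; exists (q j); apply: bij_iso_by.
apply: dsum_indep => //.
- by move=> l; case: eqP.
(* With $q_j w = q_j v$, the difference $v - w$ has no component in $U_j$. *)
- move=> v _; have [w Ww wE] := q_surj _ (morph_in (mq j) (I : fullset v)).
  exists (fun l => if l == j then w else q l (v - w)); split=> [l|].
    by case: eqP => // _; apply: (morph_in (mq l)).
  rewrite (bigD1 j) //= eqxx (eq_bigr (fun l => q l (v - w))); last first.
    by move=> l /negPf ->.
  apply: (addrI (- w)); rewrite addKr addrC [LHS](qsum (v - w)) // (bigD1 j) //=.
  by rewrite (morphB sV (mq j)) // wE subrr add0r.
move=> x xP xsum.
have xj : Ws i (x j) by move: (xP j); rewrite eqxx.
have xl l : l != j -> Us l (x l) by move=> /negPf lj; move: (xP l); rewrite lj.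
(* Applying $q_j$ to the relation leaves only $q_j(x_j)$, and $q_j$ is injective on $W_i$. *)
have xj0 : x j = 0.
  apply: q_inj => //; rewrite -(morph0 sV (mq j)) -xsum (morph_sum sV (mq j)) //.
  rewrite (bigD1 j) //= big1 ?addr0 // => l lj.
  by apply: (q0 j l); [rewrite eq_sym|apply: xl].
have [_ [_ [_ uniq]]] := DU.
apply: (uniq x (fun=> 0)) => [l|l|]; last by rewrite xsum big1.
  by have [->|/xl//] := eqVneq l j; rewrite xj0; apply: submod0.
exact: submod0.
Qed.

(* The summands U_0, U_1, ... are traded one at a time for summands W_(s j);
   s is injective since the W_(s j) end up in direct sum. *)
Lemma dsum_injection n m (Ws : 'I_n -> V -> Prop) (Us : 'I_m -> V -> Prop) :
  dsum (@fullset V) Ws -> (forall i, indecomposable (Ws i)) ->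
  dsum (@fullset V) Us -> (forall j, indecomposable (Us j)) ->
  exists s : 'I_m -> 'I_n, injective s /\ forall j, isomorphic (Us j) (Ws (s j)).
Proof.
move=> DW indW DU indU.
(* The starting map has arbitrary values, but ['I_n] must be inhabited once ['I_m] is; an exchange
   provides the element. *)
have /choice[s0 _] : forall j : 'I_m, exists i : 'I_n, True.
  by move=> j; have [i _] := dsum_exchange DW indW DU (indU j); exists i.
have step k : (k <= m)%N -> exists s : 'I_m -> 'I_n,
    dsum (@fullset V) (fun j => if (j < k)%N then Ws (s j) else Us j) /\
    forall j : 'I_m, (j < k)%N -> isomorphic (Us j) (Ws (s j)).
  elim: k => [|k IHk] lekm; first by exists s0.
  have [s [D iso]] := IHk (ltnW lekm); pose j0 := Ordinal lekm.
  have [|i] := dsum_exchange (j := j0) DW indW D; rewrite ltnn //.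
  move=> [isoi Di]; exists (fun j => if j == j0 then i else s j); split.
    congr (dsum _ _): Di; apply: funext => j; rewrite ltnS.
    have [->|nej] := eqVneq j j0; first by rewrite leqnn.
    rewrite [(j <= k)%N]leq_eqVlt; case: eqP => // E.
    by case/eqP: nej; apply: val_inj.
  move=> j; rewrite ltnS; have [->|nej] := eqVneq j j0 => //.
  rewrite leq_eqVlt => /orP[/eqP E|]; last exact: iso.
  by case/eqP: nej; apply: val_inj.
have [s [D iso]] := step m (leqnn m).
have {step}D : dsum (@fullset V) (fun j => Ws (s j)).
  by congr (dsum _ _): D; apply: funext => j; rewrite ltn_ord.
exists s; split=> [j l sjl|j]; last exact: iso.
have [[sV _] [_ [[w [Ww nw0]] _]]] := (fullset_rat_sub ratV, indW (s j)).
have [c [_ _ cid c0]] := dsum_proj sV D.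
apply: contrapT => /eqP nejl; apply: nw0.
by rewrite -(cid j w Ww) (c0 j l w) // -sjl.
Qed.

End Uniqueness.

Theorem theorem6p5 :
  forall V : sl2mod, rational V ->
    (* finite length: a Jordan–Hölder filtration by rational submodules *)
    (exists (n : nat) (Ws : nat -> V -> Prop), composition_series n Ws) /\
    (* Krull–Schmidt: a Remak decomposition into indecomposables with local
       endomorphism rings ... *)
    (exists (n : nat) (Ws : 'I_n -> V -> Prop),
        dsum (@fullset V) Ws /\
        forall i, indecomposable (Ws i) /\ local_end (Ws i)) /\
    (* ... unique up to reordering and isomorphism *)
    (forall (n m : nat) (Ws : 'I_n -> V -> Prop) (Us : 'I_m -> V -> Prop),
        dsum (@fullset V) Ws -> (forall i, indecomposable (Ws i)) ->
        dsum (@fullset V) Us -> (forall j, indecomposable (Us j)) ->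
        exists e : n = m, exists s : 'S_m,
          forall i : 'I_n, isomorphic (Ws i) (Us (s (cast_ord e i)))).
Proof.
move=> V ratV; have rV := fullset_rat_sub ratV; split; [|split].
- have [n [Ws [W0 Wn rWs step]]] := composition_chain ratV rV.
  by exists n, Ws; split; [rewrite W0; split|split; [rewrite Wn; split|]].
- have [n [Ws [D ind]]] := remak_decomposition ratV rV.
  exists n, Ws; split=> // i; split=> //.
  exact: (indecomposable_local_end ratV (ind i)).
move=> n m Ws Us DW indW DU indU.
(* Injections in both directions force [n = m], and then the injection [s] of a finite set into
   itself is a permutation. *)
have [s [s_inj iso]] := dsum_injection ratV DU indU DW indW.
have [t [t_inj _]] := dsum_injection ratV DW indW DU indU.
have e : n = m.
  have := leq_card s s_inj; have := leq_card t t_inj; rewrite !card_ord.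
  by move=> mn nm; apply/eqP; rewrite eqn_leq nm mn.
exists e; case: m / e Us {DU indU t t_inj} s s_inj iso => Us s s_inj iso.
by exists (perm s_inj) => i; rewrite permE cast_ord_id.
Qed.
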